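(* There is an absolute constant $C>0$ such that for every finite graph $G=(V,E)$ and every integer $r$ with $1\le r\le\log\vartheta(\overline G)$, \[K(r,G)\le C\,\frac{\log\vartheta(\overline G)}{r}.\]
   Context: For a finite graph $G=(V,E)$, a symmetric matrix $A\colon V\times V\to\mathbb{R}$ and a positive integer $r$, $\mathrm{SDP}_r(G,A)=\max\{\sum_{\{u,v\}\in E}A(u,v)f(u)\cdot f(v): f\colon V\to S^{r-1}\}$, with $S^{r-1}$ the unit sphere of $\mathbb{R}^r$, and $\mathrm{SDP}_\infty(G,A)$ is defined likewise with $f$ taking values in the unit sphere of $\ell^2$ (equivalently $\mathrm{SDP}_{|V|}(G,A)$). $K(r,G)$ is the smallest constant with $\mathrm{SDP}_\infty(G,A)\le K(r,G)\,\mathrm{SDP}_r(G,A)$ for all symmetric $A$. The theta number of the complement of $G$ is $\vartheta(\overline G)=\min\{\lambda: Z\in\mathbb{R}^{V\times V}\text{ positive semidefinite},\ Z(u,u)=\lambda-1\ (u\in V),\ Z(u,v)=-1\ (\{u,v\}\in E)\}$. *)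

(* Defs.v *)
From HB Require Import structures.
From mathcomp Require Import all_boot all_order all_algebra.
From mathcomp Require Import boolp classical_sets reals exp.
Set Implicit Arguments. Unset Strict Implicit. Unset Printing Implicit Defensive.
Import Order.TTheory GRing.Theory Num.Theory.
Local Open Scope ring_scope.
Local Open Scope classical_set_scope.

Definition simple_graph (V : finType) (e : rel V) : Prop :=
  symmetric e /\ irreflexive e.

Definition dotr (R : realType) (r : nat) (x y : 'rV[R]_r) : R :=
  \sum_(i < r) x ord0 i * y ord0 i.

Definition on_sphere (R : realType) (r : nat) (x : 'rV[R]_r) : Prop :=
  dotr x x = 1.

(* sum_{ {u,v} in E } A(u,v) f(u).f(v); each unordered edge appears twice
   among ordered pairs (u,v) with e u v, hence the factor 1/2. *)
Definition sdp_obj (R : realType) (V : finType) (e : rel V) (A : V -> V -> R)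
    (r : nat) (f : V -> 'rV[R]_r) : R :=
  2^-1 * \sum_(u : V) \sum_(v : V | e u v) A u v * dotr (f u) (f v).

Definition SDP (R : realType) (V : finType) (e : rel V) (A : V -> V -> R)
    (r : nat) : R :=
  sup [set sdp_obj e A f | f in [set f : V -> 'rV[R]_r | forall u, on_sphere (f u)]].

Definition SDPinf (R : realType) (V : finType) (e : rel V) (A : V -> V -> R) : R :=
  SDP e A #|V|.

Definition symmetric_mat (R : realType) (V : finType) (A : V -> V -> R) : Prop :=
  forall u v, A u v = A v u.

Definition Kconst (R : realType) (V : finType) (e : rel V) (r : nat) : R :=
  inf [set K : R | forall A : V -> V -> R, symmetric_mat A ->
                     SDPinf e A <= K * SDP e A r].

Definition psd (R : realType) (V : finType) (Z : V -> V -> R) : Prop :=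
  symmetric_mat Z /\
  forall x : V -> R, 0 <= \sum_(u : V) \sum_(v : V) x u * Z u v * x v.

Definition theta_compl (R : realType) (V : finType) (e : rel V) : R :=
  inf [set lam : R | exists Z : V -> V -> R, psd Z /\
         (forall u, Z u u = lam - 1) /\ (forall u v, e u v -> Z u v = -1)].

Arguments theta_compl {R V} e.
Arguments Kconst {R V} e r.
Arguments SDP {R V} e A r.
Arguments SDPinf {R V} e A.

(* Main.v *)
Require Import Defs.
From HB Require Import structures.
From mathcomp Require Import all_boot all_order all_algebra.
From mathcomp Require Import ring lra.
From mathcomp Require Import boolp classical_sets reals sequences exp.
Import Order.TTheory GRing.Theory Num.Theory.
Local Open Scope ring_scope.

(** Given unit vectors [f u], apply a random [r x n] sign matrix to obtain [h u]
    in [R^r], and split [h = T + S], where [S u] is [h u] if [|h u|^2 > M] and [0]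
    otherwise. The [T u] lie in the ball of radius [sqrt M], so the objective at
    [T] is at most [M * SDP_r], while the mean objective at [h] is [r] times the
    one at [f]. The terms involving [S] are Gram matrices of vectors in [L^2]: a
    Gram matrix with diagonal at most [B] has objective at most [B * SDPinf], and
    at least [- (lam - 1) * B * SDPinf], because multiplying it entrywise by a
    feasible matrix [Z] of the theta program changes its sign on the edges.
    Sub-Gaussian tails make [E |S u|^2] exponentially small in [M], so a multiple
    [M] of [ln theta] suffices. Random signs replace the Gaussian matrix of the
    usual argument in order to have a finite probability space; the price is that
    the mixed terms [E (h u . S v)] are no longer proportional to [f u . f v]. *)

(** * Positive semidefinite matrices as Gram matrices *)

Section PsdFactorization.
Variables (R : realType) (V : finType).
Implicit Types (P : V -> V -> R) (x : V -> R).

Lemma sum_pred1l (F : V -> R) w : \sum_u (u == w)%:R * F u = F w.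
Proof.
rewrite (bigD1 w) //= eqxx mul1r big1 ?addr0 // => u /negPf ->.
by rewrite mul0r.
Qed.

Lemma quad_form_shift P x w (t : R) : symmetric_mat P ->
  \sum_u \sum_v (x u + t * (u == w)%:R) * P u v * (x v + t * (v == w)%:R) =
  \sum_u \sum_v x u * P u v * x v + 2 * t * (\sum_u x u * P u w) + t ^+ 2 * P w w.
Proof.
move=> Psym.
have inner u : \sum_v (x u + t * (u == w)%:R) * P u v * (x v + t * (v == w)%:R)
  = \sum_v x u * P u v * x v + t * (x u * P u w)
    + t * ((u == w)%:R * \sum_v (P u v * x v)) + t ^+ 2 * ((u == w)%:R * P u w).
  rewrite -(sum_pred1l (P u)) !mulr_sumr -!big_split /=.
  by apply: eq_bigr => v _; ring.
rewrite (eq_bigr _ (fun u _ => inner u)) !big_split /= -!mulr_sumr.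
rewrite (sum_pred1l (fun u => \sum_v P u v * x v)) (sum_pred1l (fun u => P u w)).
have -> : \sum_v P w v * x v = \sum_u x u * P u w.
  by apply: eq_bigr => v _; rewrite Psym mulrC.
by ring.
Qed.

Lemma psd_diag_ge0 P w : psd P -> 0 <= P w w.
Proof.
move=> [Psym Pge0]; have := Pge0 (fun u => 0 + 1 * (u == w)%:R).
rewrite (quad_form_shift P (fun=> 0) w 1 Psym).
rewrite big1 => [|u _]; last by rewrite big1 // => v _; rewrite !mul0r.
by rewrite big1 => [|u _]; rewrite ?mul0r // expr1n mulr0 !add0r mul1r.
Qed.

(** With [P w w = 0] the form is affine in the coordinate at [w], and an affine function that stays
    nonnegative has slope zero. *)
Lemma psd_diag_eq0 P u w : psd P -> P w w = 0 -> P u w = 0.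
Proof.
move=> [Psym Pge0] Pw0; apply/eqP/negP => /negP Puw.
have Puu (t : R) : 0 <= P u u + 2 * t * P u w.
  have := Pge0 (fun v => (v == u)%:R + t * (v == w)%:R).
  rewrite (quad_form_shift P (fun v => (v == u)%:R) w t Psym) Pw0 mulr0 addr0.
  rewrite (sum_pred1l (fun v => P v w)).
  rewrite (eq_bigr (fun v => (v == u)%:R * P v u)); last first.
    move=> v _; rewrite -(sum_pred1l (P v) u) mulr_sumr.
    by apply: eq_bigr => v' _; ring.
  by rewrite (sum_pred1l (fun v => P v u)).
have := Puu (- (P u u + 1) / (2 * P u w)).
rewrite (_ : _ + _ = -1) ?ler0N1 //.
by field.
Qed.

Definition schur_compl P w u v : R := P u v - P u w * P v w / P w w.

(** Its form at [x] is the minimum of the form of [P] over all changes of the coordinate of [x] at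
    [w]; the minimizing change is [- s / P w w]. *)
Lemma psd_schur_compl P w : psd P -> P w w != 0 -> psd (schur_compl P w).
Proof.
move=> [Psym Pge0] Pw0; split=> [u v|x].
  by rewrite /schur_compl Psym [P u w * _]mulrC.
set s := \sum_u x u * P u w.
have := Pge0 (fun u => x u + (- s / P w w) * (u == w)%:R).
rewrite quad_form_shift // -/s => H.
suff -> : \sum_u \sum_v x u * schur_compl P w u v * x v =
  \sum_u \sum_v x u * P u v * x v - s * s / P w w.
  by apply: le_trans H _; rewrite le_eqVlt; apply/orP; left; apply/eqP; field.
rewrite {1}/s !mulr_suml -sumrB; apply: eq_bigr => u _.
rewrite /s mulr_sumr mulr_suml -sumrB; apply: eq_bigr => v _.
by rewrite /schur_compl; ring.
Qed.

(* Cholesky factorization: each step subtracts a rank-one matrix and thereby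
   clears the row and column of one more vertex. *)
Lemma psd_rank_one_sum (s : seq V) P :
  psd P -> (forall u, u \notin s -> P u u = 0) ->
  exists gs : seq (V -> R), size gs = size s /\
    forall u v, P u v = \sum_(g <- gs) g u * g v.
Proof.
elim: s P => [|w s IHs] P Ppsd Ps.
  exists [::]; split=> // u v; rewrite big_nil.
  by apply: psd_diag_eq0 => //; exact: Ps.
have [Pw0|Pw0] := eqVneq (P w w) 0.
  have [u us|gs [sz_gs gsE]] := IHs P Ppsd.
    have [->//|uw] := eqVneq u w; apply: Ps.
    by rewrite inE negb_or uw.
  (* The zero function keeps the length equal to that of the vertex list, so that the Gram vectors
     get dimension exactly [#|V|]. *)
  exists ((fun=> 0) :: gs); split=> [|u v]; first by rewrite /= sz_gs.
  by rewrite big_cons mul0r add0r.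
have Qpsd := psd_schur_compl P w Ppsd Pw0.
have Pw_gt0 : 0 < P w w by rewrite lt0r Pw0 psd_diag_ge0.
have [u us|gs [sz_gs gsE]] := IHs _ Qpsd.
  have [->|uw] := eqVneq u w; first by rewrite /schur_compl; field.
  have Pu0 : P u u = 0 by apply: Ps; rewrite inE negb_or uw.
  have [Psym _] := Ppsd.
  by rewrite /schur_compl Pu0 [P u w]Psym (psd_diag_eq0 P w u) //; ring.
exists ((fun u => P u w / Num.sqrt (P w w)) :: gs); split=> [|u v].
  by rewrite /= sz_gs.
rewrite big_cons -gsE /schur_compl.
have sq : Num.sqrt (P w w) * Num.sqrt (P w w) = P w w.
  by rewrite -expr2 sqr_sqrtr // ltW.
rewrite mulrACA -invfM sq; ring.
Qed.

Lemma psd_gram P : psd P ->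
  exists f : V -> 'rV[R]_#|V|, forall u v, dotr (f u) (f v) = P u v.
Proof.
move=> Ppsd; have [u|gs [sz_gs gsE]] := psd_rank_one_sum (enum V) P Ppsd.
  by rewrite mem_enum inE.
exists (fun u => \row_(i < #|V|) nth (fun=> 0) gs i u) => u v.
rewrite gsE (big_nth (fun=> 0)) big_mkord sz_gs -cardE /dotr.
by apply: eq_bigr => i _; rewrite !mxE.
Qed.

End PsdFactorization.

(** * The objective as a linear functional of a matrix, and its bounds *)

Section EdgeForm.
Variables (R : realType) (V : finType) (e : rel V) (A : V -> V -> R).
Implicit Types P : V -> V -> R.

(** By conversion, [sdp_obj e A f] is the value of this functional at the Gram matrix of [f]. *)
Definition edge_form P : R :=
  2^-1 * \sum_(u : V) \sum_(v : V | e u v) A u v * P u v.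

Lemma eq_edge_form P Q :
  (forall u v, e u v -> P u v = Q u v) -> edge_form P = edge_form Q.
Proof.
move=> PQ; congr (_ * _); apply: eq_bigr => u _; apply: eq_bigr => v euv.
by rewrite PQ.
Qed.

Lemma edge_formD P Q :
  edge_form (fun u v => P u v + Q u v) = edge_form P + edge_form Q.
Proof.
rewrite /edge_form -mulrDr -big_split; congr (_ * _).
apply: eq_bigr => u _; rewrite -big_split; apply: eq_bigr => v _.
by rewrite /= mulrDr.
Qed.

Lemma edge_formZ (c : R) P :
  edge_form (fun u v => c * P u v) = c * edge_form P.
Proof.
rewrite /edge_form mulrCA !mulr_sumr; apply: eq_bigr => u _.
rewrite !mulr_sumr; apply: eq_bigr => v _; ring.
Qed.

Lemma edge_form_sum (I : finType) (P : I -> V -> V -> R) :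
  edge_form (fun u v => \sum_i P i u v) = \sum_i edge_form (P i).
Proof.
rewrite /edge_form -mulr_sumr; congr (_ * _).
rewrite exchange_big; apply: eq_bigr => u _.
rewrite exchange_big; apply: eq_bigr => v _.
by rewrite mulr_sumr.
Qed.

Lemma dotr_ge0 r (x : 'rV[R]_r) : 0 <= dotr x x.
Proof. by apply: sumr_ge0 => i _; rewrite -expr2 sqr_ge0. Qed.

Lemma normr_dotr_sphere r (x y : 'rV[R]_r) :
  on_sphere x -> on_sphere y -> `|dotr x y| <= 1.
Proof.
move=> hx hy.
have split_sum (c : R) : \sum_i (x ord0 i + c * y ord0 i) ^+ 2 =
    dotr x x + (2 * c) * dotr x y + c ^+ 2 * dotr y y.
  rewrite /dotr !mulr_sumr -!big_split; apply: eq_bigr => i _ /=; ring.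
have pos (c : R) : 0 <= \sum_i (x ord0 i + c * y ord0 i) ^+ 2.
  by apply: sumr_ge0 => i _; rewrite sqr_ge0.
have := pos 1; have := pos (-1); rewrite !split_sum hx hy => h1 h2.
by rewrite ler_norml; apply/andP; split; lra.
Qed.

Lemma sdp_obj_le_SDP r (f : V -> 'rV[R]_r) :
  (forall u, on_sphere (f u)) -> sdp_obj e A f <= SDP e A r.
Proof.
move=> hf; apply: ub_le_sup; last by exists f.
(* Inner products of unit vectors lie in [-1, 1], so this number bounds every objective and [SDP] is
   a genuine supremum. *)
exists (2^-1 * \sum_(u : V) \sum_(v : V | e u v) `|A u v|) => _ [g hg <-].
rewrite /sdp_obj ler_pM2l ?invr_gt0 ?ltr0n //.
apply: ler_sum => u _; apply: ler_sum => v _.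
apply: le_trans (ler_norm _) _; rewrite normrM ler_piMr //.
exact: normr_dotr_sphere.
Qed.

Lemma dotrC r (x y : 'rV[R]_r) : dotr x y = dotr y x.
Proof. by apply: eq_bigr => i _; rewrite mulrC. Qed.

Lemma dotrDZl r (a b : R) (x y z : 'rV[R]_r) :
  dotr (a *: x + b *: y) z = a * dotr x z + b * dotr y z.
Proof.
rewrite /dotr !mulr_sumr -big_split; apply: eq_bigr => i _ /=.
rewrite !mxE; ring.
Qed.

Lemma ball_direction r (x : 'rV[R]_r.+1) : dotr x x <= 1 ->
  exists (t : R) (y : 'rV[R]_r.+1), [/\ -1 <= t <= 1, on_sphere y & x = t *: y].
Proof.
move=> x1.
have dZ (c : R) : dotr (c *: x) (c *: x) = c ^+ 2 * dotr x x.
  by rewrite /dotr mulr_sumr; apply: eq_bigr => i _; rewrite !mxE; ring.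
have [x0|x0] := eqVneq (dotr x x) 0.
  (* The zero vector has no direction of its own; positive dimension supplies a unit vector. *)
  exists 0, (delta_mx ord0 ord0); split; first by apply/andP; split; lra.
    rewrite /on_sphere /dotr big_ord_recl big1 => [|i _]; rewrite !mxE ?mulr0 //=.
    by rewrite mulr1 addr0.
  rewrite scale0r; apply/rowP => i; rewrite mxE; apply/eqP.
  rewrite -sqrf_eq0 expr2.
  have /eqP : dotr x x = 0 by [].
  rewrite psumr_eq0 => [/allP/(_ i)|j _]; last by rewrite -expr2 sqr_ge0.
  by apply; rewrite mem_index_enum.
have xp : 0 < dotr x x by rewrite lt0r x0 dotr_ge0.
have sp : 0 < Num.sqrt (dotr x x) by rewrite sqrtr_gt0.
exists (Num.sqrt (dotr x x)), ((Num.sqrt (dotr x x))^-1 *: x); split.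
- have : Num.sqrt (dotr x x) <= 1 by rewrite -[leRHS]sqrtr1 ler_sqrt.
  by move=> ?; apply/andP; split=> //; lra.
- by rewrite /on_sphere dZ exprVn sqr_sqrtr ?(ltW xp) // mulVf.
- by rewrite scalerA mulfV ?scale1r // gt_eqF.
Qed.

Hypothesis e_irr : irreflexive e.

(* Without loops the objective is affine in each vector separately, so a vector
   of the ball may be moved to one of the two ends of its diameter. *)
Lemma sdp_obj_ball r (f : V -> 'rV[R]_r.+1) :
  (forall u, dotr (f u) (f u) <= 1) -> sdp_obj e A f <= SDP e A r.+1.
Proof.
(* Induction on a list [s] of the vertices whose vectors may still lie off the sphere. *)
suff main (s : seq V) : forall f : V -> 'rV[R]_r.+1,
    (forall u, dotr (f u) (f u) <= 1) ->
    (forall u, u \notin s -> on_sphere (f u)) -> sdp_obj e A f <= SDP e A r.+1.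
  by move=> f1; apply: (main (enum V)) => // u; rewrite mem_enum inE.
elim: s => [|w s IHs] {}f f1 fs.
  by apply: sdp_obj_le_SDP => u; exact: fs.
have [t [y [/andP[t1 t2] y1 fw]]] := ball_direction _ _ (f1 w).
pose g z u := if u == w then z else f u.
have gle z : on_sphere z -> sdp_obj e A (g z) <= SDP e A r.+1.
  move=> z1; apply: IHs => u; rewrite /g.
    by case: (eqVneq u w) => // _; rewrite z1.
  case: (eqVneq u w) => // uw us.
  by apply: fs; rewrite inE negb_or uw.
have Ny : on_sphere (- y).
  by rewrite /on_sphere -[RHS]y1; apply: eq_bigr => i _; rewrite !mxE mulrNN.
have fE : sdp_obj e A f = (1 + t) / 2 * sdp_obj e A (g y)
                          + (1 - t) / 2 * sdp_obj e A (g (- y)).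
  rewrite -!edge_formZ -edge_formD; apply: eq_edge_form => u v euv.
  have fwE : f w = ((1 + t) / 2) *: y + ((1 - t) / 2) *: (- y).
    by rewrite fw scalerN -scalerBl; congr (_ *: _); field.
  rewrite /g; case: (eqVneq u w) => [uw|uw]; case: (eqVneq v w) => [vw|vw].
  - by move: euv; rewrite uw vw e_irr.
  - by rewrite uw fwE dotrDZl.
  - by rewrite vw fwE dotrC dotrDZl ![dotr _ (f u)]dotrC.
  - by field.
have := gle _ y1; have := gle _ Ny; rewrite fE => h1 h2; nra.
Qed.

(** Raising the diagonal to [B] keeps the matrix positive semidefinite and, without loops, does not
    affect the edge form; division by [B] then gives a Gram matrix of unit vectors in dimension
    [#|V|]. *)
Lemma edge_form_psd_le P (B : R) : psd P -> 0 < B ->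
  (forall u, P u u <= B) -> edge_form P <= B * SDPinf e A.
Proof.
move=> [Psym Pge0] B0 PB.
pose Q u v := B^-1 * (P u v + (u == v)%:R * (B - P u u)).
have Qpsd : psd Q.
  split=> [u v|x].
    rewrite /Q Psym eq_sym; congr (_ * (_ + _)).
    by case: eqVneq => [->//|_]; rewrite !mul0r.
  have -> : \sum_u \sum_v x u * Q u v * x v =
      B^-1 * (\sum_u \sum_v x u * P u v * x v + \sum_u (B - P u u) * x u ^+ 2).
    rewrite -big_split mulr_sumr; apply: eq_bigr => u _ /=.
    have -> : (B - P u u) * x u ^+ 2 = \sum_v (v == u)%:R * ((B - P u u) * x u * x v).
      by rewrite sum_pred1l; ring.
    rewrite -big_split mulr_sumr; apply: eq_bigr => v _ /=.
    by rewrite /Q (eq_sym u v); ring.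
  rewrite mulr_ge0 ?invr_ge0 ?(ltW B0) // addr_ge0 // sumr_ge0 // => u _.
  by rewrite mulr_ge0 ?sqr_ge0 // subr_ge0.
have [f fE] := psd_gram _ _ _ Qpsd.
have fsph u : on_sphere (f u).
  by rewrite /on_sphere fE /Q eqxx mul1r addrC subrK mulVf ?gt_eqF.
rewrite (_ : edge_form P = B * sdp_obj e A f).
  by rewrite ler_pM2l // sdp_obj_le_SDP.
rewrite -edge_formZ; apply: eq_edge_form => u v euv.
rewrite fE /Q; case: eqVneq euv => [->|_ _]; first by rewrite e_irr.
by rewrite mul0r addr0 mulVKf ?gt_eqF.
Qed.

Lemma SDPinf_ge0 : 0 <= SDPinf e A.
Proof.
rewrite -[SDPinf e A]mul1r.
have Ipsd : psd (fun u v : V => 0 : R).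
  by split=> // x; rewrite big1 // => u _; rewrite big1 // => v _; rewrite mulr0 mul0r.
apply: le_trans (edge_form_psd_le _ _ Ipsd ltr01 (fun=> ler01)).
by rewrite /edge_form big1 ?mulr0 // => u _; rewrite big1 // => v _; rewrite mulr0.
Qed.

(** Inner products in [L^2] of a finite space, summed rather than averaged: bounds on means appear
    below multiplied by the number [N] of sign matrices. *)
Definition gram {K : finType} (p : V -> K -> R) (u v : V) : R :=
  \sum_k p u k * p v k.

Lemma gram_form_le (K : finType) (p : V -> K -> R) (B : R) : 0 < B ->
  (forall u, gram p u u <= B) -> edge_form (gram p) <= B * SDPinf e A.
Proof.
move=> B0 pB; apply: edge_form_psd_le => //; split=> [u v|x].
  by rewrite /gram; apply: eq_bigr => k _; rewrite mulrC.
have -> : \sum_u \sum_v x u * gram p u v * x v = \sum_k (\sum_u x u * p u k) ^+ 2.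
  rewrite (eq_bigr (fun k => \sum_u \sum_v x u * (p u k * p v k) * x v)); last first.
    move=> k _; rewrite expr2 mulr_suml; apply: eq_bigr => u _.
    by rewrite mulr_sumr; apply: eq_bigr => v _; ring.
  rewrite [RHS]exchange_big; apply: eq_bigr => u _ /=.
  rewrite [RHS]exchange_big; apply: eq_bigr => v _ /=.
  by rewrite /gram mulr_sumr mulr_suml.
by apply: sumr_ge0 => k _; rewrite sqr_ge0.
Qed.

(* The Schur product of [gram p] with a feasible [Z] is the negative of
   [gram p] on the edges. *)
Lemma gram_form_ge (K : finType) (p : V -> K -> R) (B lam : R) Z :
  psd Z -> (forall u, Z u u = lam - 1) -> (forall u v, e u v -> Z u v = -1) ->
  1 < lam -> 0 < B -> (forall u, gram p u u <= B) ->
  - ((lam - 1) * B * SDPinf e A) <= edge_form (gram p).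
Proof.
move=> [Zsym Zge0] Zd Ze lam1 B0 pB.
have lam0 : 0 < lam - 1 by rewrite subr_gt0.
rewrite lerNl (_ : - edge_form _ = edge_form (fun u v => gram p u v * Z u v)); last first.
  rewrite -[LHS]mulN1r -edge_formZ; apply: eq_edge_form => u v euv.
  by rewrite Ze // mulN1r mulrN1.
apply: edge_form_psd_le; last 2 first.
- by rewrite mulr_gt0.
- by move=> u; rewrite Zd mulrC ler_pM2l.
split=> [u v|x].
  by rewrite Zsym; congr (_ * _); rewrite /gram; apply: eq_bigr => k _; rewrite mulrC.
(* Schur product theorem: the form splits into one form of [Z] for each [k]. *)
have -> : \sum_u \sum_v x u * (gram p u v * Z u v) * x v =
    \sum_k \sum_u \sum_v (x u * p u k) * Z u v * (x v * p v k).
  rewrite [RHS]exchange_big; apply: eq_bigr => u _ /=.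
  rewrite [RHS]exchange_big; apply: eq_bigr => v _ /=.
  by rewrite /gram mulr_suml mulr_sumr mulr_suml; apply: eq_bigr => k _; ring.
by apply: sumr_ge0 => k _; exact: (Zge0 (fun u => x u * p u k)).
Qed.

End EdgeForm.

(** * Moments and sub-Gaussian tails of random sign projections *)

Section RademacherSums.
Variable R : realType.

(** Only [1 + x <= expR x] is used. For [y >= 1/2], [y <= 2 * y ^+ 2] suffices; for smaller [y], the
    bounds [1/(1 - y)] and [1/(1 + y)] add up to [2/(1 - y ^+ 2)]. *)
Lemma cosh_le_expR (y : R) : expR y + expR (- y) <= 2 * expR (2 * y ^+ 2).
Proof.
wlog y0 : y / 0 <= y => [th|].
  have [/th//|/ltW yn] := leP 0 y.
  by have := th (- y); rewrite opprK sqrrN addrC oppr_ge0; apply.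
have [y12|y12] := leP (2^-1) y.
  have h1 : expR y <= expR (2 * y ^+ 2) by rewrite ler_expR; nra.
  have h2 : expR (- y) <= expR y by rewrite ler_expR; lra.
  lra.
have inv_bound (z : R) : z < 1 -> expR z <= (1 - z)^-1.
  move=> z1; rewrite -[expR z]invrK -expRN lef_pV2 ?posrE ?expR_gt0 ?subr_gt0 //.
  exact: expR_ge1Dx.
have h1 := inv_bound y ltac:(lra).
have h2 := inv_bound (- y) ltac:(lra).
have y2 : 0 <= y ^+ 2 <= 2^-1 by apply/andP; split; nra.
have h3 : (1 - y)^-1 + (1 - - y)^-1 = 2 / (1 - y ^+ 2).
  have p1 : 1 - y != 0 by rewrite gt_eqF //; lra.
  have p2 : 1 - - y != 0 by rewrite gt_eqF //; lra.
  have p3 : 1 - y ^+ 2 != 0 by rewrite gt_eqF //; lra.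
  by field; rewrite p1 p2 p3.
have h4 : (1 - y ^+ 2)^-1 <= expR (2 * y ^+ 2).
  apply: le_trans (expR_ge1Dx _).
  rewrite -div1r ler_pdivrMr; first by move: y2; set z := y ^+ 2; nra.
  lra.
lra.
Qed.

Definition sgn (b : bool) : R := (-1) ^+ b.

Lemma sqr_sgn b : sgn b * sgn b = 1.
Proof. by rewrite /sgn -expr2 sqrr_sign. Qed.

Definition flip {I : finType} (i : I) (w : {ffun I -> bool}) : {ffun I -> bool} :=
  [ffun j => w j (+) (j == i)].

Lemma flipK {I : finType} (i : I) : involutive (flip i).
Proof. by move=> w; apply/ffunP => j; rewrite !ffunE addbK. Qed.

Lemma sgn_flip (I : finType) (i j : I) (w : {ffun I -> bool}) :
  sgn (flip i w j) = if j == i then - sgn (w j) else sgn (w j).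
Proof. by rewrite ffunE /sgn; case: ifP => _; rewrite ?addbT ?signrN ?addbF. Qed.

(* Averaging over one sign turns the square into a cosh; the exponent grows
   slightly at each step, and [y] records the room left for this growth. *)
Lemma sum_expR_sqr_le (I : finType) (f : I -> R) (s : seq I) (y : R) :
  uniq s -> 0 <= y -> y + \sum_(i <- s) f i ^+ 2 <= 1 ->
  \sum_(w : {ffun I -> bool})
     expR ((1 + y) / 32 * (\sum_(i <- s) sgn (w i) * f i) ^+ 2) <=
  #|{ffun I -> bool}|%:R * expR ((\sum_(i <- s) f i ^+ 2) / 16).
Proof.
elim: s y => [|i s IHs] y /=.
  move=> _ _ _; rewrite big_nil mul0r expR0 mulr1.
  rewrite (eq_bigr (fun=> 1)) ?sumr_const // => w _.
  by rewrite big_nil expr0n mulr0 expR0.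
move=> /andP[is_ us] y0; rewrite big_cons => y1.
have s0 : 0 <= \sum_(j <- s) f j ^+ 2 by apply: sumr_ge0 => j _; rewrite sqr_ge0.
have f0 : 0 <= f i ^+ 2 by rewrite sqr_ge0.
pose X (w : {ffun I -> bool}) := \sum_(j <- s) sgn (w j) * f j.
pose G (w : {ffun I -> bool}) :=
  expR ((1 + y) / 32 * (\sum_(j <- i :: s) sgn (w j) * f j) ^+ 2).
have Xflip w : X (flip i w) = X w.
  rewrite /X; apply: eq_big_seq => j js; rewrite sgn_flip.
  by case: eqVneq js => // ->; rewrite (negPf is_).
have sumG : 2 * \sum_w G w = \sum_w (G w + G (flip i w)).
  have GR : \sum_w G w = \sum_w G (flip i w).
    exact: (reindex_inj (inv_inj (flipK i))).
  by rewrite big_split /= -GR; ring.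
have GE w : G w = expR ((1 + y) / 32 * (f i ^+ 2 + X w ^+ 2))
                  * expR ((1 + y) / 16 * sgn (w i) * f i * X w).
  rewrite /G big_cons -/(X w) -expRD; congr expR.
  have := sqr_sgn (w i); set z := sgn (w i) => zz.
  have -> : (z * f i + X w) ^+ 2 = (z * z) * f i ^+ 2 + X w ^+ 2 + 2 * z * f i * X w by ring.
  by rewrite zz; field.
have Gle w : G w + G (flip i w) <=
    2 * (expR (f i ^+ 2 / 16) * expR ((1 + (y + f i ^+ 2)) / 32 * X w ^+ 2)).
  rewrite !GE Xflip sgn_flip eqxx -mulrDr.
  have := sqr_sgn (w i); set z := sgn (w i) => zz.
  have -> : (1 + y) / 16 * - z * f i * X w = - ((1 + y) / 16 * z * f i * X w) by ring.
  apply: le_trans (ler_wpM2l (expR_ge0 _) (cosh_le_expR _)) _.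
  rewrite mulrCA ler_pM2l ?ltr0n // -!expRD ler_expR.
  have -> : 2 * ((1 + y) / 16 * z * f i * X w) ^+ 2 =
      (z * z) * ((1 + y) ^+ 2 / 128 * (f i ^+ 2 * X w ^+ 2)) by field.
  rewrite zz mul1r.
  have X0 : 0 <= X w ^+ 2 by rewrite sqr_ge0.
  have fX : 0 <= f i ^+ 2 * X w ^+ 2 by rewrite mulr_ge0.
  (* Since [1 + y <= 2], the cosh contributes at most [f i ^+ 2 * X w ^+ 2 / 32], exactly what
     replacing [y] by [y + f i ^+ 2] allows. *)
  have yy : (1 + y) ^+ 2 <= 4 by nra.
  have h1 : (1 + y) ^+ 2 * (f i ^+ 2 * X w ^+ 2) <= 4 * (f i ^+ 2 * X w ^+ 2).
    by rewrite ler_wpM2r.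
  have h2 : (1 + y) * f i ^+ 2 <= 2 * f i ^+ 2 by rewrite ler_wpM2r //; lra.
  lra.
have IH := IHs (y + f i ^+ 2) us ltac:(lra) ltac:(lra).
rewrite -/(\sum_w G w) in sumG *.
have : 2 * \sum_w G w <= 2 * (expR (f i ^+ 2 / 16) *
    (#|{ffun I -> bool}|%:R * expR ((\sum_(j <- s) f j ^+ 2) / 16))).
  rewrite sumG; apply: le_trans (ler_sum _ (fun w _ => Gle w)) _.
  by rewrite -!mulr_sumr ler_pM2l ?ltr0n // ler_pM2l ?expR_gt0.
rewrite ler_pM2l ?ltr0n // => /le_trans; apply.
by rewrite mulrCA -expRD mulrDl.
Qed.

Definition sign_space (r n : nat) := {ffun 'I_r -> {ffun 'I_n -> bool}}.

Definition sign_proj {r n : nat} (x : 'rV[R]_n) (w : sign_space r n) (j : 'I_r) : R :=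
  \sum_i sgn (w j i) * x ord0 i.

(** For distinct entries, flipping the entry [(j, i)] permutes the sign matrices and negates the
    summand. *)
Lemma sum_sgn_mul r n (j : 'I_r) (i i' : 'I_n) :
  \sum_(w : sign_space r n) sgn (w j i) * sgn (w j i') =
  (i' == i)%:R * #|sign_space r n|%:R.
Proof.
have [->|ii] := eqVneq i' i.
  by rewrite mul1r (eq_bigr (fun=> 1)) ?sumr_const // => w _; rewrite sqr_sgn.
rewrite mul0r.
pose flipj (w : sign_space r n) : sign_space r n :=
  [ffun k => if k == j then flip i (w k) else w k].
have flipjK : involutive flipj.
  by move=> w; apply/ffunP => k; rewrite !ffunE; case: eqP => // _; rewrite flipK.
have : \sum_(w : sign_space r n) sgn (w j i) * sgn (w j i') =
       - \sum_(w : sign_space r n) sgn (w j i) * sgn (w j i').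
  rewrite {1}(reindex_inj (inv_inj flipjK)) -sumrN; apply: eq_bigr => w _.
  by rewrite ffunE eqxx !sgn_flip eqxx (negPf ii) mulNr.
lra.
Qed.

Lemma sum_sign_proj r n (x y : 'rV[R]_n) (j : 'I_r) :
  \sum_(w : sign_space r n) sign_proj x w j * sign_proj y w j =
  #|sign_space r n|%:R * dotr x y.
Proof.
rewrite (eq_bigr (fun w : sign_space r n => \sum_i \sum_i'
   x ord0 i * y ord0 i' * (sgn (w j i) * sgn (w j i')))); last first.
  move=> w _; rewrite /sign_proj mulr_suml; apply: eq_bigr => i _.
  by rewrite mulr_sumr; apply: eq_bigr => i' _; ring.
rewrite exchange_big /dotr mulr_sumr; apply: eq_bigr => i _ /=.
rewrite exchange_big (bigD1 i) //= [X in _ + X]big1 => [|i' ii].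
  by rewrite -mulr_sumr sum_sgn_mul eqxx mul1r addr0; ring.
by rewrite -mulr_sumr sum_sgn_mul (negPf ii) mul0r mulr0.
Qed.

Definition proj_sqnorm {r n : nat} (x : 'rV[R]_n) (w : sign_space r n) : R :=
  \sum_j sign_proj x w j ^+ 2.

(** The rows are independent, so the sum is a product over [j]; each row is [sum_expR_sqr_le] at
    [y = 0]. *)
Lemma sum_expR_proj_sqnorm r n (x : 'rV[R]_n) : on_sphere x ->
  \sum_(w : sign_space r n) expR (proj_sqnorm x w / 32) <=
  #|sign_space r n|%:R * expR (r%:R / 16).
Proof.
move=> x1; rewrite /proj_sqnorm.
rewrite (eq_bigr (fun w : sign_space r n =>
   \prod_j expR ((\sum_i sgn (w j i) * x ord0 i) ^+ 2 / 32))); last first.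
  by move=> w _; rewrite mulr_suml expR_sum.
rewrite -(bigA_distr_bigA (fun _ (w : {ffun 'I_n -> bool}) =>
  expR ((\sum_i sgn (w i) * x ord0 i) ^+ 2 / 32))) /=.
rewrite prodr_const card_ord card_ffun card_ord natrX.
have -> : expR (r%:R / 16) = expR (1 / 16) ^+ r :> R.
  by rewrite -expRM_natl; congr expR; ring.
rewrite -exprMn; apply: lerXn2r; rewrite ?nnegrE ?mulr_ge0 ?expR_ge0 ?ler0n //.
  by apply: sumr_ge0 => w _; rewrite expR_ge0.
have x1' : \sum_i x ord0 i ^+ 2 = 1.
  by rewrite -[RHS]x1; apply: eq_bigr => i _; rewrite expr2.
have := @sum_expR_sqr_le _ (fun i => x ord0 i) (index_enum 'I_n) 0
  (index_enum_uniq _) (lexx _).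
rewrite x1' add0r => /(_ (lexx _)); apply: le_trans.
rewrite le_eqVlt; apply/orP; left; apply/eqP; apply: eq_bigr => w _.
by congr expR; field.
Qed.

(** Where [M < q], multiply [q <= 64 * expR (q / 64)] by [1 <= expR ((q - M) / 64)] and apply the
    exponential moment. *)
Lemma sum_proj_sqnorm_tail r n (x : 'rV[R]_n) (M : R) : on_sphere x ->
  \sum_(w : sign_space r n) (if M < proj_sqnorm x w then proj_sqnorm x w else 0) <=
  #|sign_space r n|%:R * (64 * expR (r%:R / 16 - M / 64)).
Proof.
move=> x1.
apply: (@le_trans _ _ (\sum_(w : sign_space r n)
   (64 * expR (- (M / 64))) * expR (proj_sqnorm x w / 32))); last first.
  rewrite -mulr_sumr expRD [leRHS](_ : _ = 64 * expR (- (M / 64)) *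
    (#|sign_space r n|%:R * expR (r%:R / 16))); last by ring.
  by rewrite ler_pM2l ?sum_expR_proj_sqnorm // mulr_gt0 ?expR_gt0 ?ltr0n.
apply: ler_sum => w _; set q := proj_sqnorm x w.
case: ifPn => [Mq|_]; last by rewrite !mulr_ge0 ?expR_ge0 ?ler0n.
have -> : 64 * expR (- (M / 64)) * expR (q / 32) =
    64 * expR (q / 64) * expR ((q - M) / 64).
  by rewrite -!mulrA -!expRD; congr (_ * expR _); field.
have h1 : q <= 64 * expR (q / 64) by have := expR_ge1Dx (q / 64); lra.
apply: le_trans h1 _; rewrite ler_peMr ?mulr_ge0 ?expR_ge0 ?ler0n //.
by have := expR_ge1Dx ((q - M) / 64); lra.
Qed.

End RademacherSums.

(** * Truncation of the projected vectors *)

Section Rounding.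
Variables (R : realType) (V : finType) (e : rel V) (A : V -> V -> R).
Hypothesis e_irr : irreflexive e.
Variables (r n : nat) (M : R).
Hypothesis M_gt0 : 0 < M.
Variable f : V -> 'rV[R]_n.
Hypothesis f_sphere : forall u, on_sphere (f u).

Let N : R := #|sign_space r.+1 n|%:R.
Let K : finType := (sign_space r.+1 n * 'I_r.+1)%type.

Let h (u : V) (k : K) : R := sign_proj R (f u) k.1 k.2.
Let S (u : V) (k : K) : R := if M < proj_sqnorm R (f u) k.1 then h u k else 0.
Let T (u : V) (k : K) : R := h u k - S u k.

Lemma gram_pair (p : V -> K -> R) u v :
  gram R V p u v = \sum_w \sum_j p u (w, j) * p v (w, j).
Proof. by rewrite /gram pair_bigA; apply: eq_bigr => -[]. Qed.

Lemma gram_proj u v : gram R V h u v = N * (r.+1%:R * dotr (f u) (f v)).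
Proof.
rewrite gram_pair exchange_big /= (eq_bigr (fun=> N * dotr (f u) (f v))).
  by rewrite sumr_const card_ord -mulr_natl; ring.
by move=> j _; exact: sum_sign_proj.
Qed.

Lemma gram_overflow u :
  gram R V S u u <= N * (64 * expR (r.+1%:R / 16 - M / 64)).
Proof.
rewrite gram_pair; apply: le_trans (sum_proj_sqnorm_tail _ _ _ _ M (f_sphere u)).
apply: ler_sum => w _; rewrite /S /=; case: ifP => _; last first.
  by rewrite big1 // => j _; rewrite mul0r.
by rewrite le_eqVlt; apply/orP; left; apply/eqP; apply: eq_bigr => j _; rewrite expr2.
Qed.

Lemma gram_proj_overflow (s : R) u : 0 < s ->
  gram R V (fun u k => h u k - s * S u k) u u <=
  gram R V h u u + s ^+ 2 * gram R V S u u.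
Proof.
move=> s0; rewrite /gram mulr_sumr -big_split; apply: ler_sum => k _ /=.
rewrite /S; case: ifP => _; last by rewrite !mulr0 subr0 addr0.
have : 0 <= h u k ^+ 2 by rewrite sqr_ge0.
by rewrite expr2; nra.
Qed.

(** For each fixed sign matrix, the [T u] divided by [sqrt M] lie in the unit ball of dimension
    [r.+1], where [sdp_obj_ball] applies. *)
Lemma edge_form_truncated :
  edge_form R V e A (gram R V T) <= N * (M * SDP e A r.+1).
Proof.
rewrite (_ : edge_form R V e A (gram R V T) = edge_form R V e A (fun u v =>
  \sum_w \sum_j T u (w, j) * T v (w, j))); last first.
  by apply: eq_edge_form => u v _; exact: gram_pair.
rewrite edge_form_sum /N mulr_natl -sumr_const; apply: ler_sum => w _.
have sM : Num.sqrt M * Num.sqrt M = M by rewrite -expr2 sqr_sqrtr // ltW.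
have sM0 : Num.sqrt M != 0 by rewrite gt_eqF // sqrtr_gt0.
pose g u : 'rV[R]_r.+1 := \row_j ((Num.sqrt M)^-1 * T u (w, j)).
have gE u v : M * dotr (g u) (g v) = \sum_j T u (w, j) * T v (w, j).
  rewrite /dotr mulr_sumr; apply: eq_bigr => j _; rewrite !mxE -{1}sM.
  by field.
rewrite (_ : edge_form _ _ _ _ _ = M * sdp_obj e A g); last first.
  by rewrite -edge_formZ; apply: eq_edge_form => u v _; rewrite gE.
rewrite ler_pM2l // sdp_obj_ball // => u.
rewrite -(ler_pM2l M_gt0) gE mulr1 /T /S /=.
case: ltP => [_|Mq].
  by rewrite big1 ?(ltW M_gt0) // => j _; rewrite subrr mul0r.
apply: le_trans Mq; rewrite le_eqVlt; apply/orP; left; apply/eqP.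
by apply: eq_bigr => j _; rewrite subr0 expr2.
Qed.

(* [T = h - S] gives, for every [s > 0],
   [T T' = (1 - 1/s) h h' + (h - s S) (h' - s S') / s - (s - 1) S S']:
   the mixed terms are absorbed into a Gram matrix. *)
Lemma rounding_bound (lam : R) (Z : V -> V -> R) :
  psd Z -> (forall u, Z u u = lam - 1) -> (forall u v, e u v -> Z u v = -1) ->
  2 <= lam ->
  64 * expR (r.+1%:R / 16 - M / 64) <= r.+1%:R / (64 * lam ^+ 2) ->
  (1 - (4 * lam)^-1) * (r.+1%:R * sdp_obj e A f) <=
  M * SDP e A r.+1 + 3 / 8 * r.+1%:R * SDPinf e A.
Proof.
move=> Zpsd Zd Ze lam2 tail.
set rho : R := r.+1%:R in tail *; set c := rho / (64 * _) in tail.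
set q := SDPinf e A; have q0 : 0 <= q := SDPinf_ge0 _ _ _ _ e_irr.
have N0 : 0 < N by rewrite ltr0n card_ffun card_ffun !expn_gt0 card_bool.
have rho0 : 0 < rho by rewrite ltr0n.
have lam0 : lam != 0 by rewrite gt_eqF //; lra.
have lamp : 0 < lam by lra.
have c0 : 0 < c by rewrite divr_gt0 // mulr_gt0 // ?ltr0n // exprn_gt0.
(* The Gram matrix of [h - s S] needs the lower bound, which costs a factor [lam - 1]; its weight
   [s^-1] reduces this below 1/4. The Gram matrix of [S] has negative weight [1 - s] and needs the
   upper bound. *)
set s := 4 * lam; have s0 : 0 < s by rewrite /s; lra.
have s_neq0 : s != 0 by rewrite gt_eqF.
have SB u : gram R V S u u <= N * c.
  by apply: le_trans (gram_overflow u) _; rewrite ler_pM2l.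
have hSB u : gram R V (fun u k => h u k - s * S u k) u u <= N * (rho + s ^+ 2 * c).
  apply: le_trans (gram_proj_overflow s u s0) _.
  rewrite gram_proj (f_sphere u) mulr1 mulrDr lerD2l mulrCA.
  by rewrite ler_pM2l ?exprn_gt0.
have eT : edge_form R V e A (gram R V T) =
    (1 - s^-1) * edge_form R V e A (gram R V h)
    + s^-1 * edge_form R V e A (gram R V (fun u k => h u k - s * S u k))
    + (1 - s) * edge_form R V e A (gram R V S).
  rewrite -!edge_formZ -!edge_formD; apply: eq_edge_form => u v _.
  rewrite /gram !mulr_sumr -!big_split; apply: eq_bigr => k _ /=.
  by rewrite /T; field.
have eh : edge_form R V e A (gram R V h) = N * (rho * sdp_obj e A f).
  by rewrite -!edge_formZ; apply: eq_edge_form => u v _; exact: gram_proj.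
have eS : edge_form R V e A (gram R V S) <= N * c * q.
  by apply: gram_form_le; rewrite // mulr_gt0.
have B0 : 0 < N * (rho + s ^+ 2 * c).
  by rewrite mulr_gt0 // addr_gt0 // mulr_gt0 // exprn_gt0.
have ehS := gram_form_ge _ _ _ A e_irr _ _ _ _ _ Zpsd Zd Ze ltac:(lra) B0 hSB.
have := edge_form_truncated; rewrite eT eh.
rewrite -/q in ehS.
set E1 := edge_form _ _ _ _ _ in ehS *; set E2 := edge_form _ _ _ _ _ in eS *.
move=> main.
have h1 : s^-1 * E1 >= - (s^-1 * ((lam - 1) * (N * (rho + s ^+ 2 * c)) * q)).
  by rewrite -mulrN ler_pM2l ?invr_gt0.
have h2 : (1 - s) * E2 >= (1 - s) * (N * c * q).
  by rewrite ler_wnM2l // /s; lra.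
(* Here [s ^+ 2 * c = rho / 4], so the first term is below [5 / 16 * rho]; the second is of order
   [rho / lam]. *)
have const : s^-1 * ((lam - 1) * (rho + s ^+ 2 * c)) + (s - 1) * c <= 3 / 8 * rho.
  have -> : s^-1 * ((lam - 1) * (rho + s ^+ 2 * c)) + (s - 1) * c =
     rho * (5 / 16 - (5 / 16) * lam^-1 + lam^-1 / 16 - lam^-1 ^+ 2 / 64).
    by rewrite /s /c; field.
  rewrite mulrC ler_pM2r //.
  have : 0 < lam^-1 by rewrite invr_gt0.
  by set y := lam^-1; nra.
have := ler_wpM2r (mulr_ge0 (ltW N0) q0) const => h3.
rewrite -(ler_pM2l N0).
have : (s^-1 * ((lam - 1) * (rho + s ^+ 2 * c)) + (s - 1) * c) * (N * q) =
  s^-1 * ((lam - 1) * (N * (rho + s ^+ 2 * c)) * q) - (1 - s) * (N * c * q) by ring.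
lra.
Qed.

End Rounding.

(** * From the rounding bound to the bound on [K(r,G)] *)

(** Take the supremum over [f] in [rounding_bound] and absorb the [SDPinf] term:
    [1 - (4 * lam)^-1 >= 7/8], and 7/8 - 3/8 = 1/2. *)
Lemma SDPinf_le_SDP (R : realType) (V : finType) (e : rel V) (A : V -> V -> R)
    (r : nat) (M lam : R) (Z : V -> V -> R) :
  irreflexive e -> 0 < M ->
  psd Z -> (forall u, Z u u = lam - 1) -> (forall u v, e u v -> Z u v = -1) ->
  2 <= lam ->
  64 * expR (r.+1%:R / 16 - M / 64) <= r.+1%:R / (64 * lam ^+ 2) ->
  r.+1%:R / 2 * SDPinf e A <= M * SDP e A r.+1.
Proof.
move=> e_irr M0 Zpsd Zd Ze lam2 tail.
have q0 := SDPinf_ge0 _ _ _ A e_irr.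
have bound f fs := rounding_bound _ _ _ A e_irr r #|V| _ M0 f fs _ _ Zpsd Zd Ze lam2 tail.
set rho : R := r.+1%:R in bound *.
have rho0 : 0 < rho by rewrite ltr0n.
have t8 : (4 * lam)^-1 <= 1 / 8.
  rewrite -[leRHS]invrK lef_pV2 ?posrE; lra.
have t0 : 0 < (4 * lam)^-1 by rewrite invr_gt0; lra.
set t := (4 * lam)^-1 in bound t8 t0.
have d0 : 0 < (1 - t) * rho by rewrite mulr_gt0 //; lra.
suff : SDPinf e A <= (M * SDP e A r.+1 + 3 / 8 * rho * SDPinf e A) / ((1 - t) * rho).
  rewrite ler_pdivlMr // => h.
  have : (7 / 8 - (1 - t)) * (rho * SDPinf e A) <= 0.
    by rewrite mulr_le0_ge0 //; [lra | rewrite mulr_ge0 // ltW].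
  lra.
apply: ge_sup.
  (* Distinct basis vectors show that the set of objectives is nonempty. *)
  exists (sdp_obj e A (fun u => delta_mx ord0 (enum_rank u))) => /=.
  eexists; last by []. move=> u /=.
  rewrite /on_sphere /dotr (bigD1 (enum_rank u)) //= big1 => [|i /negPf iu].
    by rewrite !mxE !eqxx mulr1 addr0.
  by rewrite !mxE iu andbF mul0r.
move=> _ [f fs <-]; rewrite ler_pdivlMr // [leLHS]mulrC -[leLHS]mulrA.
exact: bound.
Qed.

(** A feasible value within a factor 2 of the infimum suffices, so attainment of the minimum is not
    proved. *)
Lemma near_optimal_theta (R : realType) (V : finType) (e : rel V) :
  1 <= ln (theta_compl (R := R) e) ->
  exists (lam : R) (Z : V -> V -> R),
    [/\ psd Z, forall u, Z u u = lam - 1, forall u v, e u v -> Z u v = -1 &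
        2 <= lam <= 2 * theta_compl e].
Proof.
set th : R := theta_compl e => th1.
have th0 : 0 < th.
  by rewrite ltNge; apply/negP => /ln0 t0; move: th1; rewrite t0 ler10.
have th2 : 2 <= th.
  rewrite -[th]lnK ?posrE //; have := expR_ge1Dx (ln th); lra.
have hinf : has_inf [set lam : R | exists Z : V -> V -> R, psd Z /\
    (forall u, Z u u = lam - 1) /\ (forall u v, e u v -> Z u v = -1)]%classic.
  (* [inf] defaults to 0 when no infimum exists, which [0 < th] excludes. *)
  apply: contrapT => /inf_out t0; move: th0.
  by rewrite /th /theta_compl t0 ltxx.
have [lam Hlam] := inf_adherent th0 hinf.
rewrite -/(theta_compl e) -/th => lt_lam.
have lam_ge : th <= lam by apply: ge_inf Hlam; case: hinf.
case: Hlam => Z [Zpsd [Zd Ze]]; exists lam, Z; split=> //.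
by apply/andP; split; lra.
Qed.

Theorem theorem6p1 (R : realType) :
  exists C : R, 0 < C /\
    forall (V : finType) (e : rel V), simple_graph e ->
    forall r : nat,
      (1 <= (r%:R : R) <= ln (theta_compl (R := R) e)) ->
      Kconst (R := R) e r <= C * ln (theta_compl (R := R) e) / r%:R.
Proof.
(* Twice 1088, where [M = 1088 * L] and 1088 = 64 * 17. Of the 17 factors [expR (- L)] in the tail,
   one cancels [expR (rho / 16)], twelve absorb 4096 = 64 * 64 = 2^12, and four absorb [lam ^+ 2],
   as [lam <= 2 * th <= th ^+ 2]. *)
exists 2176; split; first by rewrite ltr0n.
move=> V e [_ e_irr] [|r] /andP[r1 rL]; first by rewrite ler10 in r1.
have L1 := le_trans r1 rL.
have [lam [Z [Zpsd Zd Ze /andP[lam2 lam_th]]]] := near_optimal_theta _ _ _ L1.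
set th : R := theta_compl e in rL L1 lam_th *.
set L := ln th in rL L1 *; set rho : R := r.+1%:R in r1 rL *.
have rho0 : 0 < rho by lra.
have thE : th = expR L by rewrite lnK // posrE; lra.
have e2 : 2 <= expR L by have := expR_ge1Dx L; lra.
have bound_ge0 : 0 <= 2176 * L / rho by rewrite divr_ge0 ?(ltW rho0) //; lra.
have tail : 64 * expR (rho / 16 - 1088 * L / 64) <= rho / (64 * lam ^+ 2).
  have lam_e : lam ^+ 2 <= expR L ^+ 4.
    have le_lam : lam <= expR L ^+ 2.
      by apply: le_trans lam_th _; rewrite thE expr2 ler_pM2r ?expR_gt0.
    have lam0 : 0 <= lam by lra.
    rewrite (exprM _ 2 2); apply: lerXn2r; rewrite ?nnegrE //.
    by rewrite exprn_ge0 // expR_ge0.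
  have p12 : 4096 <= expR L ^+ 12.
    rewrite (_ : 4096 = 2 ^+ 12); first by rewrite lerXn2r // nnegrE ?expR_ge0 // ler0n.
    by rewrite -natrX.
  have lam0 : 0 < 64 * lam ^+ 2 by rewrite mulr_gt0 ?ltr0n // exprn_gt0 //; lra.
  rewrite ler_pdivlMr //; apply: le_trans r1.
  have -> : expR (rho / 16 - 1088 * L / 64) = expR (rho / 16 - L) * expR (- (16 * L)).
    by rewrite -expRD; congr expR; field.
  have le1 : expR (rho / 16 - L) <= 1 by rewrite -[leRHS]expR0 ler_expR; lra.
  have e16 : expR L ^+ 12 * expR L ^+ 4 * expR (- (16 * L)) = 1.
    by rewrite -exprD -expRM_natl expRxMexpNx_1.
  rewrite [leLHS](_ : _ = expR (rho / 16 - L) *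
     (4096 * lam ^+ 2 * expR (- (16 * L)))); last by ring.
  rewrite -[leRHS]mulr1 ler_pM ?expR_ge0 //.
    by apply: mulr_ge0; [rewrite mulr_ge0 ?sqr_ge0 ?ler0n | exact: expR_ge0].
  by rewrite -[leRHS]e16 ler_pM2r ?expR_gt0 // ler_pM ?ler0n ?sqr_ge0 //.
have K_in (A : V -> V -> R) : symmetric_mat A ->
    SDPinf e A <= 2176 * L / rho * SDP e A r.+1.
  move=> _.
  have M0 : 0 < 1088 * L by lra.
  have := SDPinf_le_SDP _ _ _ A r _ _ _ e_irr M0 Zpsd Zd Ze lam2 tail.
  rewrite -/rho => le_q.
  rewrite -(ler_pM2l (_ : 0 < rho / 2)); last by rewrite divr_gt0 ?ltr0n.
  apply: le_trans le_q _; rewrite le_eqVlt; apply/orP; left; apply/eqP.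
  by field; rewrite nat1r gt_eqF.
rewrite /Kconst; set E := (X in inf X).
(* The admissible constants may be unbounded below, as for an edgeless graph; then [inf] is 0 and
   [bound_ge0] concludes. *)
have [hE|/inf_out ->//] := pselect (has_inf E).
by apply: ge_inf => //; case: hE.
Qed.
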